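(* Let $\lambda>0$ and let $N^\Gamma(t)$, $t\ge 0$, be the gamma-Poisson process (defined in the context). Then for every $t>0$, $$\Pr\{N^\Gamma(t)=k\}=\begin{cases}\dfrac{\lambda^k\,t(t+1)\cdots(t+k-1)}{k!}\,\dfrac{1}{(\lambda+1)^{t+k}}, & k\ge 1,\\[2mm] \dfrac{1}{(1+\lambda)^t}, & k=0,\end{cases}$$ that is, $$\Pr\{N^\Gamma(t)=k\}=\frac{\lambda^k\,\Gamma(k+t)}{\Gamma(t)\,k!\,(\lambda+1)^{t+k}},\qquad k\ge 0.$$
   Context: The gamma-Poisson process $N^\Gamma$ is the non-negative integer-valued process with $N^\Gamma(0)=0$ and independent and stationary increments, such that as $dt\downarrow0$, with $N^\Gamma[t,t+dt)$ the increment over $[t,t+dt)$, $$\Pr\{N^\Gamma[t,t+dt)=k\}=\begin{cases} dt\,\dfrac{\lambda^k}{k!}\displaystyle\int_0^\infty e^{-\lambda s}s^k\,\nu(ds)+o(dt), & k\ge 1,\\[2mm] 1-dt\displaystyle\int_0^\infty(1-e^{-\lambda s})\,\nu(ds)+o(dt), & k=0,\end{cases}\qquad \nu(ds)=\frac{e^{-s}}{s}\,ds.$$ For each $t$, $N^\Gamma(t)$ has the same law as $N(H^\Gamma(t))$, where $N$ is a homogeneous Poisson process of rate $\lambda$ and $H^\Gamma$ is an independent gamma subordinator, $\mathbb{E}e^{-\mu H^\Gamma(t)}=(1+\mu)^{-t}$. *)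

(* Defs.v *)
From HB Require Import structures.
From mathcomp Require Import all_boot all_order all_algebra.
From mathcomp Require Import all_classical all_reals all_analysis.
From mathcomp Require Import measurable_realfun.

Set Implicit Arguments.
Unset Strict Implicit.
Unset Printing Implicit Defensive.

Import Order.TTheory GRing.Theory Num.Theory.
Import numFieldNormedType.Exports.

Local Open Scope classical_set_scope.
Local Open Scope ring_scope.

Definition Gamma (R : realType) (x : R) : R :=
  \int[lebesgue_measure]_(s in `]0, +oo[) (s `^ (x - 1) * expR (- s)).

Definition gamma_levy_density (R : realType) : R -> R :=
  (fun s => expR (- s) / s) \_ `]0, +oo[.

Definition gamma_levy (R : realType) (A : set R) : \bar R :=
  (\int[lebesgue_measure]_(s in A) (gamma_levy_density s)%:E)%E.

Section gamma_levy_measure.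
Variable R : realType.
Local Notation mu := (@lebesgue_measure R).

Lemma gamma_levy_density_ge0 (s : R) : 0 <= gamma_levy_density s.
Proof.
apply: restrict_ge0 => {}s /=; rewrite in_itv/= andbT => s0.
by rewrite divr_ge0 ?expR_ge0 // ltW.
Qed.

Lemma measurable_gamma_levy_density :
  measurable_fun [set: R] (@gamma_levy_density R).
Proof.
apply/measurable_restrict => //; rewrite setTI.
apply: open_continuous_measurable_fun => //.
move=> s; rewrite inE/= in_itv/= andbT => s0.
apply: cvgM.
  by apply: continuous_comp; [exact: opp_continuous|exact: continuous_expR].
by apply: cvgV; rewrite ?gt_eqF.
Qed.

Let gamma_levy0 : gamma_levy (@set0 R) = 0%E.
Proof. by rewrite /gamma_levy integral_set0. Qed.

Let gamma_levy_ge0 (A : set R) : (0 <= gamma_levy A)%E.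
Proof.
by apply: integral_ge0 => s _; rewrite lee_fin; exact: gamma_levy_density_ge0.
Qed.

Let gamma_levy_sigma_additive : semi_sigma_additive (@gamma_levy R).
Proof.
move=> F mF tF mUF; rewrite /gamma_levy; apply: cvg_toP.
  apply: ereal_nondecreasing_is_cvgn => m n mn.
  apply: lee_sum_nneg_natr => // k _ _; apply: integral_ge0 => s _.
  by rewrite lee_fin gamma_levy_density_ge0.
rewrite ge0_integral_bigcup//=.
- apply/measurable_funTS/measurableT_comp => //.
  exact: measurable_gamma_levy_density.
- by move=> s _; rewrite lee_fin gamma_levy_density_ge0.
Qed.

HB.instance Definition _ := isMeasure.Build _ _ _ (@gamma_levy R)
  gamma_levy0 gamma_levy_ge0 gamma_levy_sigma_additive.

End gamma_levy_measure.

Section process.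
Context (d : measure_display) (T : measurableType d) (R : realType)
  (P : probability T R).

(* Integer-valued families; every subset of [int] is an event. Choosing
   [B i = setT] gives the product rule for every subfamily. *)
Definition mutually_independent (n : nat) (X : 'I_n -> T -> int) : Prop :=
  forall B : 'I_n -> set int,
    P [set w | forall i, B i (X i w)] = (\prod_(i < n) P (X i @^-1` B i))%E.

Implicit Type N : R -> {RV P >-> nat}.

(* Valued in [int], as [nat] subtraction truncates. *)
Definition increment N (s t : R) (w : T) : int := (N t w)%:Z - (N s w)%:Z.

Definition independent_increments N : Prop :=
  forall (n : nat) (t : nat -> R), 0 <= t 0%N -> nondecreasing_seq t ->
    mutually_independent (fun i : 'I_n => increment N (t i) (t i.+1)).

Definition stationary_increments N : Prop :=
  forall s t h : R, 0 <= s -> 0 <= t -> 0 <= h -> forall B : set int,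
    P (increment N s (s + h) @^-1` B) = P (increment N t (t + h) @^-1` B).

Definition increment_prob N (t h : R) (k : nat) : R :=
  fine (P [set w | increment N t (t + h) w = k%:Z]).

(* Only the values [N t] with [0 <= t] are constrained. By the choice operator
   behind [+o_], the equations below, for all [dt], say exactly that the error
   term is o(dt) as [dt] tends to 0 from the right. *)
Record gamma_poisson_process (lambda : R) N : Prop := GammaPoissonProcess {
  gpp_start : {ae P, forall w, N 0 w = 0%N};
  gpp_independent : independent_increments N;
  gpp_stationary : stationary_increments N;
  gpp_jump : forall t : R, 0 <= t -> forall k : nat, (1 <= k)%N -> forall dt : R,
    increment_prob N t dt k =
      dt * (lambda ^+ k / k`!%:R *
        \int[@gamma_levy R]_(s in `]0, +oo[) (expR (- lambda * s) * s ^+ k))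
      +o_(dt \near 0^'+) dt;
  gpp_nojump : forall t : R, 0 <= t -> forall dt : R,
    increment_prob N t dt 0 =
      (1 - dt *
        \int[@gamma_levy R]_(s in `]0, +oo[) (1 - expR (- lambda * s)))
      +o_(dt \near 0^'+) dt
}.

End process.

(* Main.v *)
Require Import Defs.
From HB Require Import structures.
From mathcomp Require Import all_boot all_order all_algebra.
From mathcomp Require Import all_classical all_reals all_analysis.
From mathcomp Require Import measurable_realfun.
From mathcomp Require Import ring lra zify.

Import Order.TTheory GRing.Theory Num.Theory.
Import numFieldNormedType.Exports.

(** Write [p_t] for the law of the increment over [0, t]. Stationarity and
independence of the increments make [p] a convolution semigroup of
sub-probability laws on the natural numbers ([increment_prob_conv]), and the
infinitesimal description of the process prescribes [p_h] up to an error
[o(h)], coefficient by coefficient. The proof shows that these two facts leave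
only one candidate and that the negative binomial law is one.

Uniqueness ([conv_semigroup_unique]). Fix a bound [K] and truncate all
sequences at [K]. The l1 norm of truncated sequences is submultiplicative for
the convolution ([l1norm_conv]). If two semigroups [A] and [B] agree up to
[o(h)], with [A] contractive and [B] bounded by [M] on [0, t], then telescoping
the difference of the [n]-th convolution powers of [A (t / n)] and [B (t / n)]
gives [|A t - B t| <= n * M * |A (t / n) - B (t / n)|], which is [n * o(t / n)]
and so tends to 0. No differential equation has to be solved.

The candidate. With [q = lambda / (1 + lambda)] and [L = ln (1 + lambda)], put
[negbin q L t k = t (t + 1) ... (t + k - 1) / k! * q ^ k * exp (- t L)]. It is
a convolution semigroup by the Vandermonde identity for rising factorials
([rising_Vandermonde]), and to first order in [h] it is [1 - h L] at 0 and
[h * q ^ k / k] at [k >= 1] ([negbin0_near], [negbinS_near]).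

The rates. Integrating against the Levy measure amounts to integrating against
its density ([gamma_levy_integral]). The jump rates are then gamma integrals at
integer arguments, which one integration by parts computes
([gamma_integralS], [gamma_levy_jump]): they are [q ^ k / k]. The total rate is
the Frullani integral of [(1 - exp (- lambda s)) * exp (- s) / s], which equals
[ln (1 + lambda)] because both sides, as functions of [lambda], have increments
squeezed between the same bounds, which differ by a quadratic term
([laplace_exponentE], [gamma_levy_nojump]).

The form with the Gamma function follows from [Gamma (s + 1) = s * Gamma s],
the same integration by parts, now at real arguments. *)

Local Open Scope classical_set_scope.
Local Open Scope ring_scope.

Set Implicit Arguments.
Unset Strict Implicit.
Unset Printing Implicit Defensive.

(** * Convolution semigroups of sequences *)

Section convolution.
Context {R : realType}.
Implicit Types a b : nat -> R.

Definition conv a b (k : nat) : R := \sum_(j < k.+1) a j * b (k - j)%N.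

(** Only the first [K] terms count: this is the l1 norm on power series modulo
[x ^ K]. *)
Definition l1norm (K : nat) a : R := \sum_(k < K) `|a k|.

Lemma l1norm_ge0 K a : 0 <= l1norm K a.
Proof. exact: sumr_ge0. Qed.

Lemma ler_l1norm_shift K j (b : nat -> R) :
  \sum_(k < K | (j <= k)%N) `|b (k - j)%N| <= l1norm K b.
Proof.
rewrite /l1norm -(big_mkord (fun k => (j <= k)%N) (fun k => `|b (k - j)%N|)).
rewrite -(big_mkord xpredT (fun k => `|b k|)).
have [jK|Kj] := leqP j K; last first.
  rewrite big1_seq ?sumr_ge0// => i /andP[ji]; rewrite mem_index_iota => /= iK.
  by move: (leq_ltn_trans ji iK); rewrite ltnNge (ltnW Kj).
rewrite (big_cat_nat (leq0n j) jK)/= big1_seq ?add0r; last first.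
  by move=> i /andP[ji]; rewrite mem_index_iota /= ltnNge ji.
rewrite -{1}[j]add0n big_addn -(subnK jK).
rewrite (big_cat_nat (leq0n (K - j)) (leq_addr j (K - j)))/=.
rewrite addnK (eq_big xpredT (fun k => `|b k|)).
- by rewrite lerDl sumr_ge0.
- by move=> i; rewrite leq_addl.
- by move=> i _; rewrite addnK.
Qed.

(** The left-hand side sums [`|a i| * `|b j|] over at most the triangle
[i + j < K] of the square of indices that the right-hand side sums over. *)
Lemma l1norm_conv K a b : l1norm K (conv a b) <= l1norm K a * l1norm K b.
Proof.
have -> : l1norm K a * l1norm K b = \sum_(j < K) `|a j| * l1norm K b.
  by rewrite mulr_suml.
apply: (@le_trans _ _ (\sum_(k < K) \sum_(j < K | (j <= k)%N)
    `|a j| * `|b (k - j)%N|)).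
  apply: ler_sum => k _; rewrite /conv; apply: (le_trans (ler_norm_sum _ _ _)).
  under eq_bigr do rewrite normrM.
  by rewrite (big_ord_widen K (fun j => `|a j| * `|b (k - j)%N|)).
rewrite (exchange_big_dep xpredT)//=; apply: ler_sum => j _.
by rewrite -mulr_sumr ler_wpM2l// ler_l1norm_shift.
Qed.

Lemma l1normD K a b : l1norm K (fun k => a k + b k) <= l1norm K a + l1norm K b.
Proof. by rewrite -big_split; apply: ler_sum => k _; exact: ler_normD. Qed.

Lemma l1norm_convB K a b a' b' :
  l1norm K (fun k => conv a b k - conv a' b' k) <=
  l1norm K (fun k => a k - a' k) * l1norm K b +
  l1norm K a' * l1norm K (fun k => b k - b' k).
Proof.
rewrite [leLHS](_ : _ = l1norm K (fun k => conv (fun i => a i - a' i) b k +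
    conv a' (fun i => b i - b' i) k)); last first.
  apply: eq_bigr => k _; congr `| _ |; rewrite /conv -sumrB -big_split.
  by apply: eq_bigr => j _ /=; ring.
by apply: (le_trans (l1normD _ _ _)); apply: lerD; exact: l1norm_conv.
Qed.

(** A finite sum of errors [o(h)] is [o(h)]. The errors carry no uniformity in
[k], which is why sequences are truncated. *)
Lemma l1norm_near (A : R -> nat -> R) K :
  (forall k e, 0 < e -> \forall h \near 0^'+, `|A h k| <= e * h) ->
  forall e, 0 < e -> \forall h \near 0^'+, l1norm K (A h) <= e * h.
Proof.
move=> Ao; elim: K => [|K IH] e e0.
  near=> h; rewrite /l1norm big_ord0 mulr_ge0// ltW//.
have e20 : 0 < e / 2 by rewrite divr_gt0.
near=> h; rewrite /l1norm big_ord_recr/= (splitr e) mulrDl.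
by apply: lerD; near: h; [exact: IH|exact: Ao].
Unshelve. all: by end_near. Qed.

(** Telescoping: passing from [n h] to [(n + 1) h] adds at most [M * D h] to
the distance [D], because [A h] is a contraction and [B (n h)] is bounded by
[M]. So [D t <= n M D (t / n)], and [D (t / n)] is [o(t / n)]. *)
Theorem conv_semigroup_unique (A B : R -> nat -> R) (t : R) : 0 < t ->
  (forall s u, 0 < s -> 0 < u -> A (s + u) = conv (A s) (A u)) ->
  (forall s u, 0 < s -> 0 < u -> B (s + u) = conv (B s) (B u)) ->
  (forall K s, 0 < s -> l1norm K (A s) <= 1) ->
  (forall K, exists M, forall s, 0 < s <= t -> l1norm K (B s) <= M) ->
  (forall k e, 0 < e -> \forall h \near 0^'+, `|A h k - B h k| <= e * h) ->
  A t =1 B t.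
Proof.
move=> t0 AD BD A1 BM AB k; set K := k.+1.
have [M0 {}BM] := BM K.
(* the induction below starts with D h <= M * D h, hence 1 <= M *)
pose M := Num.max M0 1.
have M1 : 1 <= M by rewrite le_max lexx orbT.
have Mgt0 : 0 < M by rewrite (lt_le_trans _ M1).
pose D s := l1norm K (fun i => A s i - B s i).
have Dn h n : 0 < h -> n.+1%:R * h <= t -> D (n.+1%:R * h) <= n.+1%:R * M * D h.
  move=> h0; elim: n => [|n IH] nt.
    by rewrite !mul1r ler_peMl// l1norm_ge0.
  have nh0 : 0 < n.+1%:R * h by rewrite mulr_gt0.
  have nht : n.+1%:R * h <= t.
    by rewrite (le_trans _ nt)// ler_wpM2r ?ltW// ltr_nat.
  have -> : n.+2%:R * h = n.+1%:R * h + h by rewrite -natr1 mulrDl mul1r.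
  rewrite /D AD// BD//; apply: (le_trans (l1norm_convB _ _ _ _ _)).
  apply: (@le_trans _ _ (D (n.+1%:R * h) * 1 + M0 * D h)).
    apply: lerD.
      by apply: ler_wpM2l; [exact: l1norm_ge0|exact: A1].
    by apply: ler_wpM2r; [exact: l1norm_ge0|rewrite BM// nh0].
  rewrite mulr1.
  have DM : M0 * D h <= M * D h.
    by rewrite ler_wpM2r ?l1norm_ge0// /M le_max lexx.
  rewrite (le_trans (lerD (IH nht) DM))//.
  by rewrite -[in leRHS]natr1 !mulrDl mul1r.
suff DM : D t <= 0.
  apply/eqP; rewrite -subr_eq0 -normr_le0 (le_trans _ DM)//.
  by rewrite /D /l1norm (bigD1 ord_max)//= lerDl sumr_ge0.
apply/ler_addgt0Pr => e e0; rewrite add0r.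
(* with this tolerance the n steps of length t / n add up to e *)
have d0 : 0 < e / (M * t) by rewrite divr_gt0// mulr_gt0.
have /(_ _ d0) := l1norm_near (A := fun s i => A s i - B s i) K AB.
rewrite near_withinE => -[r /= r0 rD].
have [n nr] : exists n : nat, t / r < n.+1%:R.
  exists (Num.truncn (t / r)); exact: truncnS_gt.
have h0 : 0 < t / n.+1%:R by rewrite divr_gt0.
have nh : n.+1%:R * (t / n.+1%:R) = t by rewrite mulrC divfK.
rewrite -{1}nh (le_trans (Dn _ n h0 _)) ?nh//.
have : D (t / n.+1%:R) <= e / (M * t) * (t / n.+1%:R).
  apply: rD => //=; rewrite sub0r normrN gtr0_norm//.
  by rewrite ltr_pdivrMr// mulrC -ltr_pdivrMr.
move/(ler_wpM2l (mulr_ge0 (ler0n R n.+1) (ltW Mgt0))) => /le_trans; apply.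
rewrite [leLHS](_ : _ = e)//; field.
by rewrite !gt_eqF// -natr1 ltr_wpDl.
Qed.

End convolution.

(** * The negative binomial semigroup *)

Section negative_binomial.
Context {R : realType}.
Implicit Types s u t : R.

(** The coefficient of [x ^ k] in [(1 - x) ^ (- s)], that is, the binomial
coefficient [s + k - 1] choose [k]. *)
Definition rising s (k : nat) : R := \prod_(i < k) (s + i%:R) / k`!%:R.

Lemma rising0 s : rising s 0 = 1.
Proof. by rewrite /rising big_ord0 fact0 divr1. Qed.

Lemma risingS s k : k.+1%:R * rising s k.+1 = (s + k%:R) * rising s k.
Proof.
rewrite /rising big_ord_recr/= factS natrM; field.
by rewrite !pnatr_eq0 -lt0n fact_gt0/= gt_eqF// -natr1 ltr_wpDl.
Qed.

Lemma risingSE s k :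
  rising s k.+1 = s * \prod_(i < k) (s + i.+1%:R) / k.+1`!%:R.
Proof. by rewrite /rising big_ord_recl/= addr0. Qed.

Lemma rising_ge0 s k : 0 <= s -> 0 <= rising s k.
Proof.
by move=> s0; rewrite divr_ge0// prodr_ge0// => i _; rewrite addr_ge0.
Qed.

Lemma ler_rising s u k : 0 <= s -> s <= u -> rising s k <= rising u k.
Proof.
move=> s0 su; rewrite ler_pM2r ?invr_gt0 ?ltr0n ?fact_gt0//.
by apply: ler_prod => i _; rewrite addr_ge0//= lerD2r.
Qed.

(** Both sides satisfy [(k + 1) x_(k + 1) = (s + u + k) x_k]. For the right-hand
side, split the factor [k + 1] of the [j]-th term as [j + (k + 1 - j)] and apply
[risingS] to each of the two factors. *)
Lemma rising_Vandermonde s u : rising (s + u) =1 conv (rising s) (rising u).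
Proof.
elim=> [|k IH]; first by rewrite /conv big_ord1 !rising0 mulr1.
have k0 : k.+1%:R != 0 :> R by rewrite pnatr_eq0.
apply: (mulfI k0); rewrite risingS IH /conv mulr_sumr.
have -> : k.+1%:R * (\sum_(j < k.+2) rising s j * rising u (k.+1 - j)%N) =
    \sum_(j < k.+2) (j%:R * rising s j) * rising u (k.+1 - j)%N +
    \sum_(j < k.+2) rising s j * ((k.+1 - j)%:R * rising u (k.+1 - j)%N).
  rewrite mulr_sumr -big_split; apply: eq_bigr => -[j /= jk] _.
  by rewrite natrB//; ring.
rewrite [X in _ = X + _]big_ord_recl/= !mul0r add0r.
rewrite [X in _ = _ + X]big_ord_recr/= subnn !mul0r mulr0 addr0.
rewrite -big_split; apply: eq_bigr => -[j /= jk] _.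
rewrite /bump/= add1n risingS subSS subSn// risingS natrB//; ring.
Qed.

(** When [L = - ln (1 - q)] this is the negative binomial mass function with
parameters [s] and [q]; the semigroup property holds for all [q] and [L]. *)
Definition negbin (q L s : R) k : R := rising s k * q ^+ k * expR (- (s * L)).

Lemma negbinD q L s u : negbin q L (s + u) = conv (negbin q L s) (negbin q L u).
Proof.
apply/funext => k; rewrite /negbin rising_Vandermonde /conv !mulr_suml.
apply: eq_bigr => -[j /= jk] _; rewrite -[in LHS](subnKC (ltnSE jk)) exprD.
by rewrite mulrDl opprD expRD addKn; ring.
Qed.

Lemma negbin_l1norm q L t K : 0 <= q -> 0 <= L ->
  exists M, forall s, 0 < s <= t -> l1norm K (negbin q L s) <= M.
Proof.
move=> q0 L0; exists (\sum_(k < K) rising t k * q ^+ k) => s /andP[s0 st].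
have {}s0 := ltW s0.
apply: ler_sum => k _; rewrite /negbin.
have rq u : 0 <= u -> 0 <= rising u k * q ^+ k.
  by move=> u0; rewrite mulr_ge0 ?rising_ge0// exprn_ge0.
rewrite ger0_norm; last by apply: mulr_ge0; [exact: rq|exact: expR_ge0].
rewrite -[leRHS]mulr1; apply: ler_pM; [exact: rq|exact: expR_ge0| |].
  by rewrite ler_wpM2r ?exprn_ge0// ler_rising.
by rewrite expR_le1 oppr_le0 mulr_ge0.
Qed.

(** From [0 <= exp (- x) - (1 - x) <= x ^ 2] at [x = h L]. *)
Lemma negbin0_near q L e : 0 <= L -> 0 < e ->
  \forall h \near 0^'+, `|negbin q L h 0 - (1 - h * L)| <= e * h.
Proof.
move=> L0 e0; near=> h; rewrite /negbin rising0 expr0 !mul1r.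
set x := h * L.
have h0 : 0 < h by near: h; exact: nbhs_right_gt.
have x0 : 0 <= x by rewrite mulr_ge0// ltW.
have := expR_ge1Dx (- x); rewrite opprD opprK addrA => ex.
rewrite ger0_norm; last lra.
have ex1 : expR (- x) <= (1 + x)^-1.
  by rewrite expRN lef_pV2 ?posrE ?expR_gt0 ?expR_ge1Dx// ltr_wpDr.
apply: (@le_trans _ _ (x ^+ 2)).
  have : (1 + x)^-1 <= 1 - x + x ^+ 2.
    rewrite invf_ple ?posrE; [|by nra|by nra].
    rewrite -[leLHS]mul1r ler_pdivrMr; last by nra.
    have : 0 <= x ^+ 3 by rewrite exprn_ge0.
    by nra.
  by lra.
rewrite /x exprMn expr2 -mulrA mulrC ler_wpM2r ?(ltW h0)// mulrC.
rewrite (@le_trans _ _ ((L ^+ 2 + 1) * h))//.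
  by rewrite ler_wpM2r ?(ltW h0)// lerDl.
rewrite mulrC -ler_pdivlMr ?ltr_wpDl ?sqr_ge0//.
by near: h; apply: nbhs_right_le; rewrite divr_gt0// ltr_wpDl ?sqr_ge0.
Unshelve. all: by end_near. Qed.

(** The rising factorial has the factor [h]; the cofactor [g] is continuous at
0, with value [q ^ (k + 1) / (k + 1)]. *)
Lemma negbinS_near q L k e : 0 < e ->
  \forall h \near 0^'+,
    `|negbin q L h k.+1 - h * (q ^+ k.+1 / k.+1%:R)| <= e * h.
Proof.
move=> e0.
pose g h : R :=
  \prod_(i < k) (h + i.+1%:R) / k.+1`!%:R * q ^+ k.+1 * expR (- (h * L)).
have gE h : negbin q L h k.+1 = h * g h.
  by rewrite /negbin risingSE /g !mulrA.
have g0 : g 0 = q ^+ k.+1 / k.+1%:R.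
  rewrite /g mul0r oppr0 expR0 mulr1 mulrC; congr (_ * _).
  under eq_bigr do rewrite add0r.
  have -> : \prod_(i < k) i.+1%:R = k`!%:R :> R.
    by rewrite -natr_prod fact_prod big_add1 /= big_mkord.
  rewrite factS natrM; field.
  by rewrite !pnatr_eq0 -lt0n fact_gt0/= gt_eqF// -natr1 ltr_wpDl.
have cP m : {for 0, continuous (fun h : R => \prod_(i < m) (h + i.+1%:R))}.
  elim: m => [|m IH]; rewrite /prop_for /continuous_at.
    by under eq_fun do rewrite big_ord0; rewrite big_ord0; exact: cvg_cst.
  under eq_fun do rewrite big_ord_recr/=.
  rewrite big_ord_recr/=; apply: cvgM => //.
  by apply: cvgD; [exact: cvg_id|exact: cvg_cst].
have cg : {for 0, continuous g}.
  apply: cvgM; last first.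
    apply: continuous_comp; last exact: continuous_expR.
    by apply: cvgN; apply: cvgM; [exact: cvg_id|exact: cvg_cst].
  by apply: cvgM; [apply: cvgM; [exact: cP|exact: cvg_cst]|exact: cvg_cst].
near=> h.
have h0 : 0 < h by near: h; exact: nbhs_right_gt.
rewrite gE -g0 -mulrBr normrM gtr0_norm// mulrC ler_wpM2r ?(ltW h0)// distrC.
by near: h; move: e e0; apply/cvgrPdist_le; exact: cvg_at_right_filter.
Unshelve. all: by end_near. Qed.

End negative_binomial.

(** * Integration against a measure with a density *)

Section density.
Context d (T : measurableType d) (R : realType).
Variables (mu nu : {measure set T -> \bar R}) (g : T -> R).
Hypotheses (g_ge0 : forall x, 0 <= g x) (mg : measurable_fun setT g).
Hypothesis nuE :
  forall A, measurable A -> nu A = (\int[mu]_(x in A) (g x)%:E)%E.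
Local Open Scope ereal_scope.
Import HBNNSimple.

Lemma nnsfun_integral_density (h : {nnsfun T >-> R}) (E : set T) :
  measurable E ->
  \int[nu]_(x in E) (h x)%:E = \int[mu]_(x in E) ((h x)%:E * (g x)%:E).
Proof.
move=> mE.
have mind r : measurable_fun E (fun x => (r * \1_(h @^-1` [set r]) x)%:E).
  by apply: (measurable_comp measurableT) => //; exact: measurable_funM.
have mgE : measurable_fun E (EFin \o g).
  by apply/measurable_EFinP; exact: measurable_funTS.
have hE x : (h x)%:E = \sum_(y \in range h) (y * \1_(h @^-1` [set y]) x)%:E.
  by rewrite fsumEFin// -fimfunE.
under eq_integral do rewrite hE.
rewrite ge0_integral_fsum//; last by move=> r x Ex; exact: nnfun_muleindic_ge0.
under [RHS]eq_integral => x xE.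
  rewrite hE ge0_mule_fsuml => [|y]; last exact: nnfun_muleindic_ge0.
  over.
rewrite ge0_integral_fsum//; last 2 first.
- by move=> y; apply: emeasurable_funM.
- by move=> r x Ex; rewrite mule_ge0 ?nnfun_muleindic_ge0// lee_fin.
apply: eq_fsbigr => r rh.
rewrite [LHS]integralZl_indic_nnsfun// integral_indic//.
have r0 : (0 <= r)%R by move: rh; rewrite inE => -[x _ <-].
under [RHS]eq_integral do rewrite EFinM -muleA.
rewrite ge0_integralZl//.
- rewrite nuE; last exact: measurableI.
  congr (_ * _); rewrite setIC integral_mkcondr.
  apply: eq_integral => x xE; rewrite epatch_indic /= muleC//.
- by apply: emeasurable_funM => //; exact/measurable_EFinP.
- by move=> x Ex; rewrite mule_ge0 ?lee_fin.
Qed.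

(** Monotone approximation by simple functions, which covers measures of
infinite mass such as the gamma Levy measure. *)
Lemma ge0_integral_density (f : T -> \bar R) (E : set T) : measurable E ->
  measurable_fun E f -> (forall x, E x -> 0 <= f x) ->
  \int[nu]_(x in E) f x = \int[mu]_(x in E) (f x * (g x)%:E).
Proof.
move=> mE mf f0.
have cf := cvg_nnsfun_approx mE mf f0.
have nd := nd_nnsfun_approx mE mf.
set h := nnsfun_approx mE mf in cf nd.
have mh n : measurable_fun E (EFin \o h n).
  by apply/measurable_EFinP; exact: measurable_funTS.
have mgE : measurable_fun E (EFin \o g).
  by apply/measurable_EFinP; exact: measurable_funTS.
have I1 : \int[nu]_(x in E) (h n x)%:E @[n --> \oo] --> \int[nu]_(x in E) f x.
  rewrite (eq_integral (fun x => limn (fun n => (h n x)%:E))); last first.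
    by move=> x /set_mem Ex; apply/esym/cvg_lim => //; exact: cf.
  apply: cvg_monotone_convergence => //.
  - by move=> n x Ex /=; rewrite lee_fin.
  - by move=> x Ex a b ab; rewrite lee_fin; exact/lefP/nd.
have I2 : \int[mu]_(x in E) ((h n x)%:E * (g x)%:E) @[n --> \oo] -->
    \int[mu]_(x in E) (f x * (g x)%:E).
  have cfg x : E x -> (h n x)%:E * (g x)%:E @[n --> \oo] --> f x * (g x)%:E.
    by move=> Ex; apply: cvgeZr => //; exact: cf.
  rewrite (eq_integral (fun x => limn (fun n => (h n x)%:E * (g x)%:E)));
      last first.
    by move=> x /set_mem Ex; apply/esym/cvg_lim => //; exact: cfg.
  apply: cvg_monotone_convergence => //.
  - by move=> n; exact: emeasurable_funM (mh n) mgE.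
  - by move=> n x Ex /=; rewrite mule_ge0 ?lee_fin.
  - move=> x Ex a b ab; rewrite lee_wpmul2r ?lee_fin//; exact/lefP/nd.
rewrite -(cvg_lim _ I1)// -(cvg_lim _ I2)//.
by under eq_fun do rewrite nnsfun_integral_density//.
Qed.

End density.

(** * Gamma integrals *)

Section improper.
Context {R : realType}.
Notation mu := (@lebesgue_measure R).

Lemma itv0y_bigcup :
  `]0%R, +oo[%classic = \bigcup_n `[n.+1%:R^-1 : R, n.+1%:R]%classic.
Proof.
apply/seteqP; split => [x|x [n _]]/=; rewrite !in_itv/= andbT; last first.
  by move=> /andP[+ _]; apply: lt_le_trans; rewrite invr_gt0.
move=> x0; exists (Num.truncn (x + x^-1)) => //=.
have /ltW xn := truncnS_gt (x + x^-1).
have xV0 : 0 < x^-1 by rewrite invr_gt0.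
rewrite in_itv/= invf_ple ?posrE//; apply/andP; split; lra.
Qed.

(** The fundamental theorem of calculus for [f - g] on the compact intervals
[[1 / n, n]], passed to the limit by monotone convergence. Keeping [f] and [g]
on separate sides lets both integrals be infinite, so that integrability can be
deduced from the identity instead of being established beforehand. *)
Lemma ge0_FTC0y (f g F : R -> R) (A B : R) :
  (forall x : R, 0 < x -> 0 <= f x) -> (forall x : R, 0 < x -> 0 <= g x) ->
  (forall x : R, 0 < x -> {for x, continuous f}) ->
  (forall x : R, 0 < x -> {for x, continuous g}) ->
  (forall x : R, 0 < x -> is_derive x 1 F (f x - g x)) ->
  F x @[x --> 0^'+] --> A -> F x @[x --> +oo] --> B ->
  (\int[mu]_(x in `]0%R, +oo[) (f x)%:E + A%:E =
   \int[mu]_(x in `]0%R, +oo[) (g x)%:E + B%:E)%E.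
Proof.
move=> f0 g0 cf cg dF FA FB.
pose I n := `[n.+1%:R^-1 : R, n.+1%:R]%classic.
have I0 n x : I n x -> 0 < x.
  by rewrite /I/= in_itv/= => /andP[+ _]; apply: lt_le_trans; rewrite invr_gt0.
have ndI : nondecreasing_seq I.
  move=> m n mn; apply/subsetPset => x; rewrite /I/= !in_itv/= => /andP[mx xm].
  rewrite (le_trans _ mx) ?(le_trans xm)//= ?ler_nat//.
  by rewrite lef_pV2 ?posrE// ler_nat.
have cI (h : R -> R) n : (forall x : R, 0 < x -> {for x, continuous h}) ->
    {within I n, continuous h}.
  move=> ch; apply: continuous_in_subspaceT => x /set_mem Ix.
  exact/ch/(I0 n).
have iI (h : R -> R) n : (forall x : R, 0 < x -> {for x, continuous h}) ->
    mu.-integrable (I n) (EFin \o h).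
  move=> ch; apply: continuous_compact_integrable; first exact: segment_compact.
  exact: cI.
have cvgI (h : R -> R) : (forall x : R, 0 < x -> 0 <= h x) ->
    (forall x : R, 0 < x -> {for x, continuous h}) ->
    (\int[mu]_(x in I n) (h x)%:E)%E @[n --> \oo] -->
    (\int[mu]_(x in `]0%R, +oo[) (h x)%:E)%E.
  move=> h0 ch; rewrite itv0y_bigcup.
  apply: ge0_nondecreasing_set_cvg_integral => //.
  - by move=> n; exact: measurable_itv.
  - by move=> n; apply: measurable_int (iI _ n ch).
  - by move=> n x Ix; rewrite lee_fin h0// (I0 n).
have FI n : (\int[mu]_(x in I n) (f x)%:E + (F n.+1%:R^-1)%:E =
    \int[mu]_(x in I n) (g x)%:E + (F n.+1%:R)%:E)%E.
  have nlt : n.+1%:R^-1 <= n.+1%:R :> R.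
    by rewrite (@le_trans _ _ 1) ?ler1n// invf_le1// ler1n.
  (* the interval is a single point when n = 0 *)
  have [n1|n1] := eqVneq (n.+1%:R^-1 : R) n.+1%:R.
    by rewrite /I n1 set_itv1 !integral_set1.
  have {}nlt : n.+1%:R^-1 < n.+1%:R :> R by rewrite lt_neqAle n1.
  have n0 : 0 < n.+1%:R^-1 :> R by rewrite invr_gt0.
  have cF x : 0 < x -> {for x, continuous F}.
    move=> x0; apply: differentiable_continuous; apply/derivable1_diffP.
    by have [] := dF _ x0.
  have := @continuous_FTC2 _ (f \- g) F _ _ nlt.
  rewrite /=; under eq_integral do rewrite EFinB.
  rewrite integralB_EFin//; [|exact: iI|exact: iI].
  move=> H.
  have {H} : (\int[mu]_(x in I n) (f x)%:E - \int[mu]_(x in I n) (g x)%:E =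
      (F n.+1%:R)%:E - (F n.+1%:R^-1)%:E)%E.
    apply: H.
    - by apply: (cI (f \- g)) => x x0; apply: cvgB; [exact: cf|exact: cg].
    - split.
      + move=> x; rewrite in_itv/= => /andP[nx _].
        by have [] := dF x (lt_trans n0 nx).
      + by apply: cvg_at_right_filter; exact: cF.
      + by apply: cvg_at_left_filter; apply: cF; rewrite ltr0n.
    - move=> x; rewrite in_itv/= => /andP[nx _].
      by rewrite derive1E; have [_ ->] := dF x (lt_trans n0 nx).
  have /fineK <- : (\int[mu]_(x in I n) (f x)%:E)%E \is a fin_num.
    by apply: integrable_fin_num; [exact: measurable_itv|exact: iI].
  have /fineK <- : (\int[mu]_(x in I n) (g x)%:E)%E \is a fin_num.
    by apply: integrable_fin_num; [exact: measurable_itv|exact: iI].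
  by rewrite -!EFinB -!EFinD => -[]?; congr EFin; lra.
have LA : (F n.+1%:R^-1)%:E @[n --> \oo] --> A%:E.
  apply: cvg_EFin; first exact: nearW.
  apply: (cvg_at_rightP _ _ _).1 FA _ _; split; last exact: cvg_harmonic.
  by move=> n; rewrite invr_gt0.
have LB : (F n.+1%:R)%:E @[n --> \oo] --> B%:E.
  apply: cvg_EFin; first exact: nearW.
  apply: (cvg_pinftyP _ _).1 FB _ _.
  apply/cvgryPge => M; near=> n.
  apply: (@le_trans _ _ n%:R); last by rewrite ler_nat.
  by near: n; exact: nbhs_infty_ger.
have Lf := cvgeD (fin_num_adde_defl _ _) (cvgI f f0 cf) LA.
have Lg := cvgeD (fin_num_adde_defl _ _) (cvgI g g0 cg) LB.
rewrite -(cvg_lim _ (Lf _ isT))// -(cvg_lim _ (Lg _ isT))//.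
by under eq_fun do rewrite FI.
Unshelve. all: by end_near. Qed.

End improper.

Section gamma_integral.
Context {R : realType}.
Notation mu := (@lebesgue_measure R).
Implicit Types a s x : R.

Definition gamma_integrand a s x : R := x `^ (s - 1) * expR (- (a * x)).

Definition gamma_integral a s : \bar R :=
  (\int[mu]_(x in `]0%R, +oo[) (gamma_integrand a s x)%:E)%E.

Lemma gamma_integrand_ge0 a s x : 0 <= gamma_integrand a s x.
Proof. by rewrite mulr_ge0 ?powR_ge0 ?expR_ge0. Qed.

Lemma gamma_integral_ge0 a s : (0 <= gamma_integral a s)%E.
Proof. by apply: integral_ge0 => x _; rewrite lee_fin gamma_integrand_ge0. Qed.

Lemma is_derive_continuous (f : R -> R) x df :
  is_derive x 1 f df -> {for x, continuous f}.
Proof. by move=> [/derivable1_diffP/differentiable_continuous]. Qed.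

Lemma is_derive_expRN a x :
  is_derive x 1 (fun y => expR (- (a * y))) (- (a * expR (- (a * x)))).
Proof.
have dl := is_deriveZ (- a) (is_derive_id x (1 : R)).
have -> : (fun y => expR (- (a * y))) = expR \o ((- a) \*: id).
  by apply/funext => y; rewrite -mulNr.
apply: is_derive_eq (is_derive1_comp (is_derive_expR _) dl) _.
by rewrite -[LHS]/(expR (- a * x) * (- a * 1)); rewrite mulNr; ring.
Qed.

Lemma continuous_gamma_integrand a s x : 0 < x ->
  {for x, continuous (gamma_integrand a s)}.
Proof.
move=> x0; apply: cvgM.
  exact: is_derive_continuous (is_derive1_powR (s - 1) x0).
exact: is_derive_continuous (is_derive_expRN a x).
Qed.

Lemma measurable_gamma_integrand a s :
  measurable_fun (`]0, +oo[%classic : set R) (EFin \o gamma_integrand a s).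
Proof.
apply/measurable_EFinP; apply: open_continuous_measurable_fun => // x.
by rewrite inE/= in_itv/= andbT; exact: continuous_gamma_integrand.
Qed.

Lemma cvg_expRN a : 0 < a -> expR (- (a * x)) @[x --> +oo] --> (0 : R).
Proof.
move=> a0; apply: (@cvg_comp _ _ _ (fun x => a * x) (fun z => expR (- z))
    _ (pinfty_nbhs R)); last exact: cvgr_expR.
exact: gt0_cvgMry.
Qed.

Lemma gamma_integral1 a : 0 < a -> gamma_integral a 1 = (a^-1)%:E.
Proof.
move=> a0.
have -> : gamma_integral a 1 =
    (\int[mu]_(x in `]0%R, +oo[) (expR (- (a * x)))%:E)%E.
  by apply: eq_integral => x _; rewrite /gamma_integrand subrr powRr0 mul1r.
have dF x : is_derive x 1 (fun y => a^-1 - a^-1 * expR (- (a * y)))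
    (expR (- (a * x)) - 0).
  have H := is_deriveB (is_derive_cst a^-1 x (1 : R))
    (is_deriveZ a^-1 (is_derive_expRN a x)).
  apply: is_derive_eq H _.
  rewrite -[LHS]/(0 - a^-1 * - (a * expR (- (a * x)))); field.
  by rewrite gt_eqF.
have cE x : {for x, continuous (fun y => expR (- (a * y)))}.
  exact: is_derive_continuous (is_derive_expRN a x).
have := @ge0_FTC0y R (fun x => expR (- (a * x))) (fun=> 0)
  (fun x => a^-1 - a^-1 * expR (- (a * x))) 0 a^-1.
rewrite (@integral0_eq _ _ _ _ _ (fun=> 0%E))// add0e adde0; apply => //.
- by move=> x _; exact: cvg_cst.
- have : a^-1 - a^-1 * expR (- (a * x)) @[x --> 0^'+] -->
      a^-1 - a^-1 * expR (- (a * 0)).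
    apply: cvg_at_right_filter.
    exact: (is_derive_continuous (dF 0)).
  by rewrite mulr0 oppr0 expR0 mulr1 subrr.
- rewrite -[in X in _ --> X](subr0 a^-1) -[in X in _ --> _ - X](mulr0 a^-1).
  apply: cvgB; first exact: cvg_cst.
  by apply: cvgM; [exact: cvg_cst|exact: cvg_expRN].
Qed.

(** Half of the exponential absorbs the power: [x ^ s * exp (- a x / 2)] is the
[s]-th power of [x * exp (- c x)] with [c = a / (2 s)], and
[x * exp (- c x) <= 1 / c]. *)
Lemma cvg_gamma_primitive_y a s : 0 < a -> 0 < s ->
  x `^ s * expR (- (a * x)) @[x --> +oo] --> (0 : R).
Proof.
move=> a0 s0.
have a20 : 0 < a / 2 by rewrite divr_gt0.
apply: (@squeeze_cvgr _ _ _ _ (cst 0)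
    (fun x => (2 * s / a) `^ s * expR (- (a / 2 * x)))).
- near=> x; rewrite mulr_ge0 ?powR_ge0 ?expR_ge0//=.
  have x0 : 0 < x by near: x; exact: nbhs_pinfty_gt.
  have -> : expR (- (a * x)) = expR (- (a / 2 * x)) * expR (- (a / 2 * x)).
    by rewrite -expRD; congr expR; field.
  rewrite mulrA ler_wpM2r ?expR_ge0// expRN -ler_pdivlMr ?invr_gt0 ?expR_gt0//.
  rewrite invrK.
  have -> : a / 2 * x = (a / (2 * s) * x) * s by field; rewrite gt_eqF.
  rewrite expRM -powRM ?expR_ge0//; last by rewrite divr_ge0 ?mulr_ge0 ?ltW.
  apply: ge0_ler_powR; rewrite ?nnegrE ?mulr_ge0 ?divr_ge0 ?expR_ge0
    ?invr_ge0 ?(ltW s0) ?(ltW x0) ?(ltW a0)//.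
  have e1 := expR_ge1Dx (a / (2 * s) * x).
  rewrite [leLHS](_ : _ = 2 * s / a * (a / (2 * s) * x)); last first.
    by field; rewrite !gt_eqF.
  rewrite ler_wpM2l ?divr_ge0 ?mulr_ge0 ?(ltW s0) ?(ltW a0)//.
  by rewrite (le_trans _ e1)// lerDr.
- exact: cvg_cst.
- rewrite -[in X in _ --> X](mulr0 ((2 * s / a) `^ s)).
  by apply: cvgM; [exact: cvg_cst|exact: cvg_expRN].
Unshelve. all: by end_near. Qed.

(** Integration by parts with primitive [x ^ s * exp (- a x)], which vanishes at
both ends; the identity holds in the extended reals. *)
Lemma gamma_integralS a s : 0 < a -> 0 < s ->
  (a%:E * gamma_integral a (s + 1) = s%:E * gamma_integral a s)%E.
Proof.
move=> a0 s0.
have := @ge0_FTC0y R (fun x => s * gamma_integrand a s x)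
  (fun x => a * gamma_integrand a (s + 1) x)
  (fun x => x `^ s * expR (- (a * x))) 0 0.
rewrite !adde0 => H.
rewrite -ge0_integralZl ?lee_fin ?ltW//; last 2 first.
- exact: measurable_gamma_integrand.
- by move=> x _; rewrite lee_fin gamma_integrand_ge0.
rewrite -ge0_integralZl ?lee_fin ?ltW//; last 2 first.
- exact: measurable_gamma_integrand.
- by move=> x _; rewrite lee_fin gamma_integrand_ge0.
apply/esym/H.
- by move=> x x0; rewrite mulr_ge0 ?gamma_integrand_ge0 ?ltW.
- by move=> x x0; rewrite mulr_ge0 ?gamma_integrand_ge0 ?ltW.
- move=> x x0.
  by apply: cvgM; [exact: cvg_cst|exact: continuous_gamma_integrand].
- move=> x x0.
  by apply: cvgM; [exact: cvg_cst|exact: continuous_gamma_integrand].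
- move=> x x0; have dp := is_derive1_powR s x0; have de := is_derive_expRN a x.
  apply: is_derive_eq (is_deriveM dp de) _.
  rewrite /gamma_integrand addrK -[LHS]/(x `^ s * - (a * expR (- (a * x))) +
    expR (- (a * x)) * (s * x `^ (s - 1))); ring.
- rewrite -[in X in _ --> X](mul0r (expR (- (a * 0)))).
  apply: cvgM; first exact: powR_cvg0.
  apply: cvg_at_right_filter.
  exact: is_derive_continuous (is_derive_expRN a 0).
- exact: cvg_gamma_primitive_y.
Qed.

Lemma gamma_integral_nat a k : 0 < a ->
  gamma_integral a k.+1%:R = (k`!%:R / a ^+ k.+1)%:E.
Proof.
move=> a0; elim: k => [|k IH]; first by rewrite gamma_integral1// fact0 div1r.
have := @gamma_integralS a k.+1%:R a0; rewrite ltr0n natr1 => /(_ isT).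
rewrite IH => /(congr1 (fun z => (a^-1)%:E * z)%E).
rewrite muleA -EFinM mulVf ?gt_eqF// mul1e => ->.
rewrite -!EFinM factS natrM; congr EFin.
by rewrite [in RHS](exprS a k.+1) invfM; ring.
Qed.

(** By [gamma_integralS] it is enough to treat [s + 1], where [x ^ s] is at most
[1 + x ^ n] for a natural number [n >= s]; the two resulting integrals are
given by [gamma_integral_nat]. *)
Lemma gamma_integral_fin_num a s : 0 < a -> 0 < s ->
  gamma_integral a s \is a fin_num.
Proof.
move=> a0 s0.
suff : (gamma_integral a (s + 1) < +oo)%E.
  rewrite !ge0_fin_numE ?gamma_integral_ge0// => fy.
  have := gamma_integralS a0 s0 => /(congr1 (fun z => (s^-1)%:E * z)%E).
  rewrite muleA -EFinM muleA -EFinM mulVf ?gt_eqF// mul1e => <-.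
  by rewrite lte_mul_pinfty// lee_fin mulr_ge0 ?invr_ge0 ?ltW.
pose n := Num.truncn s.
have sn : s <= n.+1%:R by rewrite ltW// truncnS_gt.
apply: (@le_lt_trans _ _ (gamma_integral a 1 + gamma_integral a n.+2%:R)%E).
  rewrite -ge0_integralD//=; last 4 first.
  - by move=> x _; rewrite lee_fin gamma_integrand_ge0.
  - exact: measurable_gamma_integrand.
  - by move=> x _; rewrite lee_fin gamma_integrand_ge0.
  - exact: measurable_gamma_integrand.
  apply: ge0_le_integral => //=.
  - by move=> x _; rewrite lee_fin gamma_integrand_ge0.
  - exact: measurable_gamma_integrand.
  - by apply: emeasurable_funD; exact: measurable_gamma_integrand.
  - move=> x; rewrite in_itv/= andbT => x0.
    rewrite -EFinD lee_fin -mulrDl ler_wpM2r ?expR_ge0//.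
    rewrite subrr powRr0 addrK -natr1 addrK.
    have [x1|/ltW x1] := leP x 1.
      rewrite ler_wpDr ?powR_ge0// -(powRr0 x) ger_powR ?x0//; exact: ltW.
    by rewrite ler_wpDl// ler_powR.
by rewrite gamma_integral1// gamma_integral_nat// -EFinD ltry.
Qed.

(** Again it is enough to treat [s + 1], where the integrand is at least
[exp (- 2 a)] on [[1, 2]]. *)
Lemma gamma_integral_gt0 a s : 0 < a -> 0 < s -> (0 < gamma_integral a s)%E.
Proof.
move=> a0 s0.
suff : (0 < gamma_integral a (s + 1))%E.
  move=> p; have := gamma_integralS a0 s0.
  move: p; rewrite !lt0e !gamma_integral_ge0 !andbT => /negPf p /eqP.
  apply: contraTneq => ->; rewrite mule0 mule_eq0 p orbF eqe gt_eqF//.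
apply: (@lt_le_trans _ _
    (\int[mu]_(x in `[1%R, 2%R]) (expR (- (a * 2)))%:E)%E).
  rewrite integral_cst//= lebesgue_measure_itv/= lte_fin ltr1n -EFinB.
  by rewrite -EFinM lte_fin mulr_gt0 ?expR_gt0// subr_gt0 ltr1n.
apply: (@le_trans _ _
    (\int[mu]_(x in `[1%R, 2%R]) (gamma_integrand a (s + 1) x)%:E)%E).
  have sub : (`[1, 2]%classic : set R) `<=` `]0, +oo[%classic.
    move=> x/=; rewrite !in_itv/= andbT => /andP[+ _]; exact: lt_le_trans.
  apply: ge0_le_integral => //=.
  - by apply: (measurable_funS _ sub) => //; exact: measurable_gamma_integrand.
  - move=> x; rewrite in_itv/= => /andP[x1 x2].
    rewrite lee_fin /gamma_integrand addrK -[leLHS]mul1r ler_pM ?expR_ge0//.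
      by rewrite -(powRr0 x) ler_powR// ltW.
    by rewrite ler_expR lerN2 ler_wpM2l// ltW.
apply: ge0_subset_integral => //=.
- exact: measurable_gamma_integrand.
- by move=> x _; rewrite lee_fin gamma_integrand_ge0.
- move=> x/=; rewrite !in_itv/= andbT => /andP[+ _]; exact: lt_le_trans.
Qed.

Lemma GammaE s : Gamma s = fine (gamma_integral 1 s).
Proof.
rewrite /Gamma /Rintegral; congr fine; apply: eq_integral => x _.
by rewrite /gamma_integrand mul1r.
Qed.

Lemma Gamma_gt0 s : 0 < s -> 0 < Gamma s.
Proof.
move=> s0; rewrite GammaE fine_gt0// gamma_integral_gt0//=.
by rewrite -ge0_fin_numE ?gamma_integral_ge0 ?gamma_integral_fin_num.
Qed.

Lemma GammaS s : 0 < s -> Gamma (s + 1) = s * Gamma s.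
Proof.
move=> s0; have := gamma_integralS ltr01 s0; rewrite mul1e !GammaE => ->.
by rewrite fineM// gamma_integral_fin_num.
Qed.

Lemma Gamma_rising s k : 0 < s ->
  Gamma (k%:R + s) = \prod_(i < k) (s + i%:R) * Gamma s.
Proof.
move=> s0; elim: k => [|k IH]; first by rewrite big_ord0 mul1r add0r.
rewrite -natr1 addrAC GammaS; last by rewrite ltr_wpDl.
by rewrite IH big_ord_recr/=; ring.
Qed.

End gamma_integral.

(** * The rates given by the gamma Levy measure *)

Section levy_measure.
Context {R : realType}.
Notation mu := (@lebesgue_measure R).
Implicit Types a x y : R.

Lemma gamma_levy_integral (f : R -> R) :
  measurable_fun (`]0, +oo[%classic : set R) f ->
  (forall x, 0 < x -> 0 <= f x) ->
  \int[@gamma_levy R]_(x in `]0, +oo[) f x =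
  fine (\int[mu]_(x in `]0%R, +oo[) (f x * (expR (- x) / x))%:E)%E.
Proof.
move=> mf f0; rewrite /Rintegral; congr fine.
(* The Levy measure and the Lebesgue measure live on two structures with the
   same Borel sets but distinct displays; the identity transports the former. *)
pose toB : R -> measurableTypeR R := id.
have mtoB : measurable_fun setT toB by move=> _ A mA; rewrite setTI.
have mD : measurable (`]0, +oo[%classic : set (measurableTypeR R)).
  exact: measurable_itv.
have mEf :
    measurable_fun (`]0, +oo[%classic : set (measurableTypeR R)) (EFin \o f).
  exact/measurable_EFinP.
have Ef0 : {in (`]0, +oo[%classic : set (measurableTypeR R)),
    forall x, (0 <= (EFin \o f) x)%E}.
  by move=> x; rewrite inE/= in_itv/= andbT => x0; rewrite lee_fin f0.
have H := @ge0_integral_pushforward _ _ _ _ _ toB mtoB (@gamma_levy R) _ _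
  mD mEf Ef0.
apply: (etrans (esym H)).
rewrite (@ge0_integral_density _ _ _ mu _ (@gamma_levy_density R))//.
- apply: eq_integral => x; rewrite inE/= => x0.
  by rewrite -EFinM /gamma_levy_density patchE mem_set.
- exact: gamma_levy_density_ge0.
- exact: measurable_gamma_levy_density.
- by move=> x/=; rewrite in_itv/= andbT => x0; rewrite lee_fin f0.
Qed.

(** The factor [exp (- s) / s] of the density turns the integrand into that of
the gamma integral with rate [lambda + 1] and exponent [k]. *)
Lemma gamma_levy_jump (lambda : R) k : 0 < lambda -> (0 < k)%N ->
  lambda ^+ k / k`!%:R *
    \int[@gamma_levy R]_(s in `]0, +oo[) (expR (- lambda * s) * s ^+ k) =
  (lambda / (1 + lambda)) ^+ k / k%:R.
Proof.
move=> l0; case: k => // k _.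
have l1 : 0 < lambda + 1 by rewrite ltr_wpDl// ltW.
rewrite gamma_levy_integral; last 2 first.
- apply: open_continuous_measurable_fun => // x _; apply: cvgM.
    apply: continuous_comp; last exact: continuous_expR.
    by apply: cvgM; [exact: cvg_cst|exact: cvg_id].
  exact: exprn_continuous.
- by move=> x x0; rewrite mulr_ge0 ?expR_ge0// exprn_ge0// ltW.
rewrite [X in fine X](_ : _ = gamma_integral (lambda + 1) k.+1%:R).
  rewrite gamma_integral_nat//= factS natrM [1 + _]addrC expr_div_n; field.
  by rewrite !gt_eqF ?exprn_gt0 ?ltr0n ?fact_gt0.
apply: eq_integral => x; rewrite inE/= in_itv/= andbT => x0; congr EFin.
rewrite /gamma_integrand -natr1 addrK powR_mulrn; last exact: ltW.
rewrite exprS mulrDl mul1r opprD expRD mulNr; field.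
by rewrite gt_eqF.
Qed.

(** Cutting [[0, t]] into [n] equal parts bounds [|f t - f 0|] by
[n * (t / n) ^ 2]. *)
Lemma cst_of_quadratic_increments (f : R -> R) t :
  (forall x y, 0 <= x <= y -> `|f y - f x| <= (y - x) ^+ 2) ->
  0 <= t -> f t = f 0.
Proof.
move=> fq t0; apply/eqP; rewrite -subr_eq0 -normr_le0.
have fn h n : 0 <= h -> `|f (n%:R * h) - f 0| <= n%:R * h ^+ 2.
  move=> h0; elim: n => [|n IH]; first by rewrite !mul0r subrr normr0.
  rewrite -[f (n.+1%:R * h)](subrK (f (n%:R * h))) -addrA.
  rewrite (le_trans (ler_normD _ _))// -[in leRHS]nat1r mulrDl mul1r lerD//.
  have e : n.+1%:R * h - n%:R * h = h by rewrite -natr1; ring.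
  rewrite -[in leRHS]e fq// mulr_ge0//= ler_wpM2r// ler_nat.
  by rewrite leqnSn.
apply/ler_addgt0Pr => e e0; rewrite add0r.
pose n := Num.truncn (t ^+ 2 / e).
have n0 : n.+1%:R != 0 :> R by rewrite pnatr_eq0.
have := fn (t / n.+1%:R) n.+1 (divr_ge0 t0 (ler0n _ _)).
rewrite mulrCA divff// mulr1 => /le_trans; apply.
have -> : n.+1%:R * (t / n.+1%:R) ^+ 2 = t ^+ 2 / n.+1%:R by field.
rewrite ler_pdivrMr// mulrC -ler_pdivrMr// ltW//; exact: truncnS_gt.
Qed.

(** The function [psi] such that the gamma subordinator at time [t] has Laplace
transform [exp (- t psi)], in its Levy-Khintchine form. *)
Definition laplace_exponent a : \bar R :=
  (\int[mu]_(x in `]0%R, +oo[)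
    ((1 - expR (- (a * x))) * (expR (- x) / x))%:E)%E.

Let mexp a :
  measurable_fun (`]0, +oo[%classic : set R) (fun x => expR (- (a * x))).
Proof.
apply: open_continuous_measurable_fun => // x _.
exact: is_derive_continuous (is_derive_expRN a x).
Qed.

Let mdens :
  measurable_fun (`]0, +oo[%classic : set R) (fun x => expR (- x) / x).
Proof.
apply: open_continuous_measurable_fun => // x.
rewrite inE/= in_itv/= andbT => x0.
apply: cvgM; last by apply: cvgV; [rewrite gt_eqF|exact: cvg_id].
by apply: continuous_comp; [exact: opp_continuous|exact: continuous_expR].
Qed.

Let mlap a : measurable_fun (`]0, +oo[%classic : set R)
  (fun x => (1 - expR (- (a * x))) * (expR (- x) / x)).
Proof. by apply: measurable_funM => //; apply: measurable_funB. Qed.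

Let lap_ge0 a x : 0 <= a -> 0 < x ->
  0 <= (1 - expR (- (a * x))) * (expR (- x) / x).
Proof.
move=> a0 x0; rewrite mulr_ge0 ?divr_ge0 ?expR_ge0 ?(ltW x0)//.
by rewrite subr_ge0 expR_le1 oppr_le0 mulr_ge0// ltW.
Qed.

Let scaled_exp (d a : R) : 0 <= d -> 0 < a ->
  (\int[mu]_(x in `]0%R, +oo[) (d * expR (- (a * x)))%:E = (d / a)%:E)%E.
Proof.
move=> d0 a0; rewrite EFinM -gamma_integral1// -ge0_integralZl//.
- apply: eq_integral => x _.
  by rewrite /gamma_integrand subrr powRr0 mul1r EFinM.
- exact: measurable_gamma_integrand.
- by move=> x _; rewrite lee_fin gamma_integrand_ge0.
Qed.

(** The increment is the integral of
[(exp (- x s) - exp (- y s)) * exp (- s) / s], which lies between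
[(y - x) * exp (- (1 + y) s)] and [(y - x) * exp (- (1 + x) s)]. *)
Lemma laplace_exponent_incr x y : 0 <= x <= y ->
  (laplace_exponent x + ((y - x) / (1 + y))%:E <= laplace_exponent y <=
   laplace_exponent x + ((y - x) / (1 + x))%:E)%E.
Proof.
move=> /andP[x0 xy]; have y0 := le_trans x0 xy.
have d0 : 0 <= y - x by rewrite subr_ge0.
rewrite -!scaled_exp ?ltr_pwDl//.
have mE d a : measurable_fun (`]0, +oo[%classic : set R)
    (fun s => (d * expR (- (a * s)))%:E).
  by apply/measurable_EFinP; apply: measurable_funM.
have mL a : measurable_fun (`]0, +oo[%classic : set R)
    (fun s => ((1 - expR (- (a * s))) * (expR (- s) / s))%:E).
  exact/measurable_EFinP.
have L0 a s : 0 <= a -> (`]0, +oo[%classic : set R) s ->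
    (0 <= ((1 - expR (- (a * s))) * (expR (- s) / s))%:E)%E.
  by move=> a0; rewrite /= in_itv/= andbT => s0; rewrite lee_fin lap_ge0.
have E0 a s : (0 <= ((y - x) * expR (- (a * s)))%:E)%E.
  by rewrite lee_fin mulr_ge0// expR_ge0.
(* both bounds amount to 1 + v <= expR v, at v = u and at v = - u *)
have key s : 0 < s ->
    (y - x) * expR (- ((1 + y) * s)) <=
    (expR (- (x * s)) - expR (- (y * s))) * (expR (- s) / s) <=
    (y - x) * expR (- ((1 + x) * s)).
  move=> s0; pose u := (y - x) * s.
  have eu : expR (- (x * s)) = expR u * expR (- (y * s)).
    by rewrite -expRD; congr expR; rewrite /u; ring.
  have eu' : expR (- (y * s)) = expR (- u) * expR (- (x * s)).
    by rewrite -expRD; congr expR; rewrite /u; ring.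
  have split1 a : (y - x) * expR (- ((1 + a) * s)) =
      (u * expR (- (a * s))) * (expR (- s) / s).
    rewrite (mulrDl 1 a s) mul1r opprD expRD /u; field.
    by rewrite gt_eqF.
  have ds : 0 <= expR (- s) / s by rewrite divr_ge0 ?expR_ge0 ?ltW.
  rewrite !split1; apply/andP; split; apply: ler_wpM2r => //.
    rewrite eu -[X in _ - X]mul1r -mulrBl ler_wpM2r ?expR_ge0//.
    by rewrite lerBrDl expR_ge1Dx.
  rewrite eu' -[X in X - _]mul1r -mulrBl ler_wpM2r ?expR_ge0//.
  by rewrite lerBlDl -lerBlDr expR_ge1Dx.
rewrite -!ge0_integralD//=.
all: try by move=> s Ds; exact: L0.
all: try exact: mL.
all: try exact: mE.
apply/andP; split; apply: ge0_le_integral => //=.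
- by move=> s Ds; rewrite adde_ge0 ?L0.
- exact: emeasurable_funD (mL x) (mE _ _).
- exact: mL.
- move=> s; rewrite in_itv/= andbT => /key/andP[+ _].
  rewrite -EFinD lee_fin; lra.
- by move=> s Ds; rewrite L0.
- exact: mL.
- exact: emeasurable_funD (mL x) (mE _ _).
- move=> s; rewrite in_itv/= andbT => /key/andP[_].
  rewrite -EFinD lee_fin; lra.
Qed.

Lemma ln1D_incr x y : 0 <= x <= y ->
  (y - x) / (1 + y) <= ln (1 + y) - ln (1 + x) <= (y - x) / (1 + x).
Proof.
move=> /andP[x0 xy]; have y0 := le_trans x0 xy.
have x1 : 0 < 1 + x by rewrite ltr_pwDl.
have y1 : 0 < 1 + y by rewrite ltr_pwDl.
(* the lower bound is this upper bound with the endpoints exchanged *)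
have N1 a b : 0 < 1 + a -> 0 < 1 + b ->
    ln (1 + b) - ln (1 + a) <= (b - a) / (1 + a).
  move=> a1 b1; rewrite -ln_div ?posrE//.
  have -> : (1 + b) / (1 + a) = 1 + (b - a) / (1 + a) by field; rewrite gt_eqF.
  apply: le_ln1Dx; rewrite ltr_pdivlMr//; lra.
rewrite N1// andbT; have := N1 _ _ y1 x1.
by rewrite -[x - y]opprB mulNr; lra.
Qed.

(** The bounds in [laplace_exponent_incr] and [ln1D_incr] are the same and
differ by at most [(y - x) ^ 2], so the difference of the two functions is
constant. *)
Lemma laplace_exponentE a : 0 <= a -> laplace_exponent a = (ln (1 + a))%:E.
Proof.
have L00 : laplace_exponent 0 = 0%E.
  by apply: integral0_eq => s _; rewrite mul0r oppr0 expR0 subrr mul0r.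
have Lfin x : 0 <= x -> laplace_exponent x \is a fin_num.
  move=> x0; have := @laplace_exponent_incr 0 x; rewrite lexx L00 !add0e.
  move=> /(_ x0)/andP[+ /le_lt_trans]; rewrite ge0_fin_numE.
    by move=> _ /(_ +oo%E); apply; rewrite ltry.
  apply: integral_ge0 => s; rewrite /= in_itv/= andbT => s0.
  by rewrite lee_fin lap_ge0.
move=> a0; rewrite -(fineK (Lfin _ a0)); congr EFin; apply/eqP.
rewrite -subr_eq0; apply/eqP.
rewrite (@cst_of_quadratic_increments
  (fun x => fine (laplace_exponent x) - ln (1 + x)))//.
  by rewrite L00 addr0 ln1 subrr.
move=> x y xy; have /andP[x0 xley] := xy; have y0 := le_trans x0 xley.
have := laplace_exponent_incr xy; have := ln1D_incr xy.
rewrite -(fineK (Lfin _ x0)) -(fineK (Lfin _ y0)) -!EFinD !lee_fin /=.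
have : (y - x) / (1 + x) - (y - x) / (1 + y) <= (y - x) ^+ 2.
  have x1 : 0 < 1 + x by rewrite ltr_pwDl.
  have y1 : 0 < 1 + y by rewrite ltr_pwDl.
  have -> : (y - x) / (1 + x) - (y - x) / (1 + y) =
      (y - x) ^+ 2 / ((1 + x) * (1 + y)) by field; rewrite !gt_eqF.
  rewrite ler_pdivrMr ?mulr_gt0// ler_peMr ?sqr_ge0//; nra.
move=> H /andP[? ?] /andP[? ?].
by rewrite ler_norml; apply/andP; split; lra.
Qed.

Lemma gamma_levy_nojump (lambda : R) : 0 < lambda ->
  \int[@gamma_levy R]_(s in `]0, +oo[) (1 - expR (- lambda * s)) =
  ln (1 + lambda).
Proof.
move=> l0; rewrite gamma_levy_integral.
- rewrite -[RHS]/(fine (ln (1 + lambda))%:E) -laplace_exponentE ?ltW//.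
  by congr fine; apply: eq_integral => x _; rewrite mulNr.
- have -> : (fun s => 1 - expR (- lambda * s)) =
      (fun s => 1 - expR (- (lambda * s))).
    by apply/funext => s; rewrite mulNr.
  exact: measurable_funB.
- by move=> x x0; rewrite subr_ge0 expR_le1 mulNr oppr_le0 mulr_ge0// ltW.
Qed.

End levy_measure.

(** * Laws of the increments *)

Section process_law.
Context (d : measure_display) (T : measurableType d) (R : realType)
  (P : probability T R) (lambda : R) (N : R -> {RV P >-> nat}).
Hypothesis N_gpp : gamma_poisson_process lambda N.

Lemma measurable_increment s u (B : set int) :
  measurable (increment N s u @^-1` B).
Proof.
have -> : increment N s u @^-1` B =
    \bigcup_m (N s @^-1` [set m] `&` N u @^-1` [set n | B (n%:Z - m%:Z)]).
  apply/seteqP; split => [w Bw|w [m _ [/= <-]]//].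
  by exists (N s w).
apply: bigcupT_measurable => m; apply: measurableI.
  by rewrite -[X in measurable X]setTI; exact: measurable_funP.
by rewrite -[X in measurable X]setTI; exact: measurable_funP.
Qed.

Lemma eq_measure_off_null (A B Z : set T) :
  measurable A -> measurable B -> measurable Z -> P Z = 0%E ->
  (forall w, ~ Z w -> A w <-> B w) -> P A = P B.
Proof.
move=> mA mB mZ Z0 AB.
have PD C : measurable C -> P C = P (C `\` Z).
  move=> mC; rewrite (measureDI P mC mZ).
  rewrite [X in (_ + X)%E](_ : _ = 0%E) ?adde0//.
  by apply: (subset_measure0 _ mZ _ Z0); [exact: measurableI|exact: subIsetr].
rewrite PD// (PD B)//; congr (P _); apply/seteqP; split => w [ABw nZ];
  by split => //; apply/(AB w nZ).
Qed.

Let measurable_start : measurable [set w | N 0 w <> 0%N].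
Proof. exact: (measurable_funPTI (N 0) (Y := [set~ 0%N])). Qed.

Lemma start_null : P [set w | N 0 w <> 0%N] = 0%E.
Proof.
have [Z [mZ Z0 NZ]] := gpp_start N_gpp.
exact: (subset_measure0 measurable_start mZ NZ Z0).
Qed.

Lemma increment_stationary (s u : R) (B : set int) : 0 <= s -> 0 <= u ->
  P (increment N s (s + u) @^-1` B) = P (increment N 0 u @^-1` B).
Proof.
by move=> s0 u0; rewrite (gpp_stationary N_gpp s0 (lexx 0) u0) add0r.
Qed.

(** Stationarity moves the increment to [0, u], where it can only be negative if
[N 0] is not 0. *)
Lemma increment_lt0 (s u : R) : 0 <= s -> 0 <= u ->
  P (increment N s (s + u) @^-1` [set z | z < 0]) = 0%E.
Proof.
move=> s0 u0; rewrite increment_stationary//.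
apply: subset_measure0 start_null; last first.
- by move=> w /=; rewrite /increment => ww N0; move: ww; rewrite N0 subr0.
- exact: measurable_start.
- exact: measurable_increment.
Qed.

Lemma increment_prob_fin t k :
  (increment_prob N 0 t k)%:E = P (increment N 0 t @^-1` [set k%:Z]).
Proof.
rewrite /increment_prob add0r fineK//.
exact: fin_num_measure P _ (measurable_increment 0 t [set k%:Z]).
Qed.

Lemma increment_probE t k :
  P [set w | N t w = k] = (increment_prob N 0 t k)%:E.
Proof.
rewrite increment_prob_fin.
apply: eq_measure_off_null start_null _.
- by rewrite -[X in measurable X]/(N t @^-1` [set k]); exact: measurable_funPTI.
- exact: (measurable_increment 0 t [set k%:Z]).
- exact: measurable_start.
- move=> w /contrapT N0; rewrite /= /increment N0 subr0.
  by split => [->//|[]].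
Qed.

Lemma increment_prob_l1norm K (t : R) :
  0 < t -> l1norm K (increment_prob N 0 t) <= 1.
Proof.
move=> t0; rewrite -lee_fin /l1norm -sumEFin.
rewrite (eq_bigr (fun k : 'I_K =>
    P (increment N 0 t @^-1` [set (k : nat)%:Z]))); last first.
  move=> k _; rewrite -increment_prob_fin ger0_norm//.
  by rewrite /increment_prob fine_ge0.
rewrite -measure_semi_additive_ord//=.
- apply: probability_le1; apply: bigsetU_measurable => k _.
  exact: measurable_increment.
- by move=> k; exact: measurable_increment.
- apply/trivIsetP => i j _ _ ij; apply/seteqP; split => // w.
  by move=> [/= -> [/ord_inj/eqP]]; rewrite (negbTE ij).
- by apply: bigsetU_measurable => k _; exact: measurable_increment.
Qed.

(** Off a null set the increments over [0, s] and [s, s + u] are nonnegative,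
so that their sum is [k] exactly when the first is some [j <= k] and the second
is [k - j]; these events are disjoint, and independence and stationarity give
their probabilities. *)
Lemma increment_prob_conv (s u : R) : 0 < s -> 0 < u ->
  increment_prob N 0 (s + u) =
  conv (increment_prob N 0 s) (increment_prob N 0 u).
Proof.
move=> /ltW s0 /ltW u0; apply/funext => k; apply: EFin_inj.
rewrite increment_prob_fin.
pose E j := increment N 0 s @^-1` [set j%:Z] `&`
  increment N s (s + u) @^-1` [set k%:Z - j%:Z].
have mE j : measurable (E j).
  by apply: measurableI; exact: measurable_increment.
have PE (j : 'I_k.+1) :
    P (E j) = (increment_prob N 0 s j * increment_prob N 0 u (k - j)%N)%:E.
  (* the times 0, s, s + u, followed by a constant tail *)
  pose t n : R := if n is n'.+1 then (if n' is _.+1 then s + u else s) else 0.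
  have ndt : nondecreasing_seq t.
    apply/nondecreasing_seqP => -[|[|n]] //=; first by rewrite lerDl.
  pose B (i : 'I_2) : set int :=
    if i == ord0 then [set j%:Z] else [set k%:Z - j%:Z].
  have := gpp_independent N_gpp (n := 2) (t := t) (lexx 0) ndt B.
  rewrite !big_ord_recl big_ord0 mule1 /=.
  have -> : [set w | forall i : 'I_2, B i (increment N (t i) (t i.+1) w)] = E j.
    apply/seteqP; split => w.
      by move=> Bw; split; [exact: (Bw ord0)|exact: (Bw (lift ord0 ord0))].
    move=> [E1 E2] i.
    have [->|i1] : i = ord0 \/ i = lift ord0 ord0; last 2 first.
    - exact: E1.
    - by rewrite i1.
    case: i => -[|[|]]// ?; [left|right]; exact: val_inj.
  move=> ->; rewrite EFinM !increment_prob_fin//; congr (_ * _)%E.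
  rewrite -(increment_stationary _ s0 u0); congr (P (_ @^-1` [set _])).
  by rewrite subzn// -ltnS.
rewrite /conv -sumEFin; under [RHS]eq_bigr do rewrite -PE.
rewrite -measure_semi_additive_ord//=; last 2 first.
- apply/trivIsetP => i j _ _ ij; apply/seteqP; split => // w [[Ei _] [Ej _]].
  by move: Ei; rewrite /= Ej => -[/ord_inj/eqP]; rewrite eq_sym (negbTE ij).
- exact: bigsetU_measurable.
pose Z := increment N 0 (0 + s) @^-1` [set z | z < 0] `|`
  increment N s (s + u) @^-1` [set z | z < 0].
have mZ : measurable Z by apply: measurableU; exact: measurable_increment.
apply: (@eq_measure_off_null _ _ Z) => //.
- exact: measurable_increment.
- exact: bigsetU_measurable.
- apply: measure_negligible => //; apply: negligibleU.
    by apply/negligibleP; [exact: measurable_increment|exact: increment_lt0].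
  by apply/negligibleP; [exact: measurable_increment|exact: increment_lt0].
move=> w nZ; rewrite -bigcup_mkord; split.
  move=> /= Hk.
  have i1 : 0 <= increment N 0 s w.
    by rewrite leNgt; apply/negP => n; apply: nZ; left; rewrite /= add0r.
  have i2 : 0 <= increment N s (s + u) w.
    by rewrite leNgt; apply/negP => n; apply: nZ; right.
  have sum : increment N 0 s w + increment N s (s + u) w = k%:Z.
    by rewrite -Hk /increment; ring.
  exists `|increment N 0 s w|%N => /=.
    by rewrite ltnS; lia.
  by split => /=; lia.
move=> [j _ [/= E1 E2]]; rewrite /preimage/=.
have -> : increment N 0 (s + u) w = increment N 0 s w + increment N s (s + u) w.
  by rewrite /increment; ring.
by rewrite E1 E2; ring.
Qed.

End process_law.

(** * Identification of the law *)

Section identification.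
Context {R : realType}.

(** The error term in the equation is produced by a choice operator, and the
equation for all [h] says exactly that [f - g] is [o(h)]. *)
Lemma eqaddo_near0 (f g : R -> R) :
  (forall h, f h = g h +o_(h \near 0^'+) h) ->
  forall e, 0 < e -> \forall h \near 0^'+, `|f h - g h| <= e * h.
Proof.
move=> fg e e0.
have /eqaddoP : f = g +o_ (0^'+) id by apply/funext.
move=> /(_ e e0) H; near=> h.
have h0 : 0 < h by near: h; exact: nbhs_right_gt.
rewrite -[X in e * X]gtr0_norm//; near: h; exact: H.
Unshelve. all: by end_near. Qed.

Lemma negbinE (lambda t : R) k : 0 < lambda ->
  negbin (lambda / (1 + lambda)) (ln (1 + lambda)) t k =
  lambda ^+ k * \prod_(i < k) (t + i%:R) / k`!%:R *
    (1 / (lambda + 1) `^ (t + k%:R)).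
Proof.
move=> l0; have l1 : 0 < 1 + lambda by rewrite ltr_pwDl// ltW.
rewrite [lambda + 1]addrC powRD; last by apply/implyP => _; rewrite gt_eqF.
rewrite powR_mulrn; last exact: ltW.
rewrite /negbin /rising expr_div_n.
have -> : expR (- (t * ln (1 + lambda))) = ((1 + lambda) `^ t)^-1.
  by rewrite expRN /powR gt_eqF.
field.
by rewrite !gt_eqF ?powR_gt0 ?exprn_gt0 ?ltr0n ?fact_gt0.
Qed.

End identification.

Lemma gamma_poisson_law (d : measure_display) (T : measurableType d)
  (R : realType) (P : probability T R) (lambda : R) (N : R -> {RV P >-> nat}) :
  0 < lambda -> gamma_poisson_process lambda N -> forall t, 0 < t ->
  increment_prob N 0 t =1 negbin (lambda / (1 + lambda)) (ln (1 + lambda)) t.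
Proof.
move=> l0 gN t t0; have l1 : 0 < 1 + lambda by rewrite ltr_pwDl// ltW.
have q0 : 0 <= lambda / (1 + lambda) by rewrite divr_ge0 ?ltW.
have L0 : 0 <= ln (1 + lambda) by rewrite ln_ge0// lerDl ltW.
apply: conv_semigroup_unique t0 _ _ _ _ _.
- by move=> s u; exact: increment_prob_conv gN _ _.
- by move=> s u _ _; exact: negbinD.
- by move=> K s s0; exact: increment_prob_l1norm.
- by move=> K; exact: negbin_l1norm.
- move=> k e e0; have e20 : 0 < e / 2 by rewrite divr_gt0.
  (* g is the common first order expansion *)
  suff [g [gA gB]] : exists g : R -> R,
      (\forall h \near 0^'+, `|increment_prob N 0 h k - g h| <= e / 2 * h) /\
      (\forall h \near 0^'+,
        `|negbin (lambda / (1 + lambda)) (ln (1 + lambda)) h k - g h|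
          <= e / 2 * h).
    near=> h; rewrite -(subrKA (g h)) (le_trans (ler_normD _ _))//.
    rewrite (splitr e) mulrDl lerD//; first by near: h.
    by rewrite distrC; near: h.
  case: k => [|k].
    exists (fun h => 1 - h * ln (1 + lambda)); split; last exact: negbin0_near.
    have := gpp_nojump gN (lexx 0); rewrite gamma_levy_nojump// => H.
    exact: (eqaddo_near0 H e20).
  exists (fun h => h * ((lambda / (1 + lambda)) ^+ k.+1 / k.+1%:R)).
  split; last exact: negbinS_near.
  have := gpp_jump gN (lexx 0) (ltn0Sn k); rewrite gamma_levy_jump// => H.
  exact: (eqaddo_near0 H e20).
Unshelve. all: by end_near. Qed.

Unset Implicit Arguments.

Theorem proposition4p4 (d : measure_display) (T : measurableType d)
  (R : realType) (P : probability T R) (lambda : R) (N : R -> {RV P >-> nat})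
  (lambda_gt0 : 0 < lambda) (N_gpp : gamma_poisson_process lambda N)
  (t : R) (t_gt0 : 0 < t) :
  [/\ forall k : nat, (1 <= k)%N ->
        P [set w | N t w = k] =
          (lambda ^+ k * \prod_(i < k) (t + i%:R) / k`!%:R
             * (1 / (lambda + 1) `^ (t + k%:R)))%:E,
      P [set w | N t w = 0%N] = (1 / (1 + lambda) `^ t)%:E
    & forall k : nat,
        P [set w | N t w = k] =
          (lambda ^+ k * Gamma (k%:R + t)
             / (Gamma t * k`!%:R * (lambda + 1) `^ (t + k%:R)))%:E].
Proof.
have PN k : P [set w | N t w = k] =
    (lambda ^+ k * \prod_(i < k) (t + i%:R) / k`!%:R
       * (1 / (lambda + 1) `^ (t + k%:R)))%:E.
  rewrite (increment_probE N_gpp).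
  by rewrite (gamma_poisson_law lambda_gt0 N_gpp t_gt0) negbinE.
split=> [k _||k]; first exact: PN.
  by rewrite PN big_ord0 fact0 expr0 addr0 mulr1 divr1 mul1r [1 + _]addrC.
rewrite PN Gamma_rising//; congr EFin; field.
rewrite !gt_eqF ?Gamma_gt0 ?powR_gt0 ?ltr0n ?fact_gt0//.
by rewrite ltr_wpDl// ltW.
Qed.
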